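(* Let $n\in\mathbb{N}$, let $\mathcal{F}$ be a shellable family of subsets of $[n]$ with $|\mathcal{F}|=n$, and let $t$ be the (unique) transversal of $\mathcal{F}$. Let $S\subseteq[n]$ be the set of elements $k\in[n]$ such that $k\in F$ for exactly one member $F$ of $\mathcal{F}$, and let $m$ be an integer with $n-|S|+1\le m\le n$. Then the average value of $A_{n,m}(f)$ over all configurations $f$ of $t$ satisfying $A_{n,m}(f)\ge 1$ equals $$\frac{m!\,S(n,m)}{\prod_{F\in\mathcal{F}}|F|},$$ where $S(n,m)$ is the Stirling number of the second kind.
   Context: $\mathbb{N}$ denotes the positive integers and $[n]=\{1,\dots,n\}$. Families of sets are treated as multisets (members counted with multiplicity; the product $\prod_{F\in\mathcal{F}}|F|$ runs over members with multiplicity). $\mathcal{F}$ is shellable if there is an ordering $F_1,\dots,F_n$ of its members with $\left|\bigcup_{i=1}^k F_i\right|=k$ for every $k\in[n]$; such a family has exactly one transversal. A transversal of $\mathcal{F}$ is an injective map $t:\mathcal{F}\to[n]$ with $t(F)\in F$ for all $F$. A configuration of $t$ is a function $f:[n]\to\mathbb{N}$ with $f(t(F))\le|F|$ for all $F\in\mathcal{F}$. A surjective map $\sigma:[n]\to[m]$ satisfies $f$ if for every $F\in\mathcal{F}$, $\sigma(t(F))$ is the $k$-th smallest element of $\sigma(F)=\{\sigma(i):i\in F\}$, where $k=f(t(F))$. $A_{n,m}(f)$ denotes the number of surjective maps $\sigma:[n]\to[m]$ that satisfy $f$. If $X$ is the set of configurations $f$ of $t$ with $A_{n,m}(f)\ge1$,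 the average value of $A_{n,m}(f)$ over these configurations is $\frac{1}{|X|}\sum_{f\in X}A_{n,m}(f)$ if $|X|>0$, and $0$ otherwise. $S(n,m)$ is the number of set partitions of $[n]$ into $m$ nonempty blocks. *)

(* Defs.v *)
From mathcomp Require Import all_boot all_order all_fingroup all_algebra.

Set Implicit Arguments.
Unset Strict Implicit.
Unset Printing Implicit Defensive.

(* The ground set [n] = {1, ..., n} is 'I_n = {0, ..., n - 1} and [m] is 'I_m;
   only the order of the elements matters. A family (multiset) of n subsets of
   [n] is given by indexing its members: F : 'I_n -> {set 'I_n}. *)

Section Families.

Variables (n : nat) (F : 'I_n -> {set 'I_n}).

(* s lists the members as F (s 0), F (s 1), ...; the first k of them are those
   with position i < k. *)
Definition shellable : Prop :=
  exists s : {perm 'I_n}, forall k : nat, 1 <= k <= n ->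
    #|\bigcup_(i : 'I_n | i < k) F (s i)| = k.

Definition family_transversal (t : 'I_n -> 'I_n) : Prop :=
  injective t /\ forall j, t j \in F j.

Definition in_exactly_one : {set 'I_n} :=
  [set x | #|[set j | x \in F j]| == 1].

Definition configuration (t : 'I_n -> 'I_n) (f : 'I_n -> nat) : bool :=
  [forall x, 0 < f x] && [forall j, f (t j) <= #|F j|].

Lemma configuration_bound (t : 'I_n -> 'I_n) (f : 'I_n -> nat) :
  family_transversal t -> configuration t f -> forall x, f x < n.+1.
Proof.
move=> [t_inj _] /andP[_ /forallP f_le] x.
have [g _ gK] := injF_bij t_inj.
rewrite ltnS -(gK x) (leq_trans (f_le _)) //.
by rewrite (leq_trans (max_card _)) ?card_ord.
Qed.

Definition kth_smallest (m k : nat) (B : {set 'I_m}) (x : 'I_m) : bool :=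
  (x \in B) && (#|[set y in B | y < x]|.+1 == k).

Definition satisfies (m : nat) (t : 'I_n -> 'I_n) (f : 'I_n -> nat)
    (sigma : 'I_n -> 'I_m) : bool :=
  [forall j, kth_smallest (f (t j)) (sigma @: F j) (sigma (t j))].

Definition num_satisfying (m : nat) (t : 'I_n -> 'I_n) (f : 'I_n -> nat) : nat :=
  #|[set sigma : {ffun 'I_n -> 'I_m} |
      [forall y, y \in codom sigma] && satisfies t f sigma]|.

(* Configurations take values in the positive integers, but those of a
   transversal are bounded by n (configuration_bound), so they are all among
   the functions to 'I_n.+1 = {0, ..., n}. *)
Definition realized_configurations (m : nat) (t : 'I_n -> 'I_n) :
    {set {ffun 'I_n -> 'I_n.+1}} :=
  [set f : {ffun 'I_n -> 'I_n.+1} |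
    configuration t (fun x => f x) && (1 <= num_satisfying m t (fun x => f x))].

Definition average_num_satisfying (m : nat) (t : 'I_n -> 'I_n) : rat :=
  let X := realized_configurations m t in
  if 0 < #|X|
  then ((\sum_(f in X) (num_satisfying m t (fun x => f x))%:R) / #|X|%:R)%R
  else 0%R.

End Families.

Definition stirling2 (n m : nat) : nat :=
  #|[set P : {set {set 'I_n}} | partition P [set: 'I_n] && (#|P| == m)]|.

(* Main.v *)
Require Import Defs.
From mathcomp Require Import all_boot all_order all_fingroup all_algebra.

Set Implicit Arguments.
Unset Strict Implicit.
Unset Printing Implicit Defensive.

(* Every surjection [n] -> [m] satisfies exactly one configuration, so the
   numbers A_{n,m}(f) sum up to the number m! S(n,m) of surjections, and it
   remains to see that all prod |F| configurations are realized.  Inserting the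
   transversal elements one by one along the shelling gives an injective map
   satisfying f.  An element x of S matters only for the member F whose
   transversal element is x, so all but m - (n - |S|) >= 1 elements of S can be
   glued: to the element of F of the prescribed rank if f x < |F|, and to a
   common top element, itself in S, if f x = |F|. *)

(** * Surjections and Stirling numbers *)

Lemma injective_onto_set (T : finType) (m : nat) (P : {set T})
    (tau : {ffun 'I_m -> T}) :
  #|P| = m ->
  (injectiveb tau && (tau @: setT == P)) =
  ((tau \in ffun_on (mem P)) && injectiveb tau).
Proof.
move=> cardP; rewrite andbC; case: injectiveP => [tau_inj|_];
  last by rewrite !andbF.
rewrite !andbT; apply/eqP/ffun_onP => [<- y|tauP].
  by rewrite imset_f ?inE.
apply/eqP; rewrite eqEcard card_imset // cardsT card_ord cardP leqnn andbT.
by apply/subsetP => _ /imsetP[y _ ->].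
Qed.

(** Grouped by image: each partition into [m] blocks is the image of [m]! injective listings. *)
Lemma card_ordered_partitions (n m : nat) :
  #|[set tau : {ffun 'I_m -> {set 'I_n}} |
      injectiveb tau && partition (tau @: setT) setT]| = m`! * stirling2 n m.
Proof.
rewrite -sum1_card.
rewrite (partition_big (fun tau : {ffun 'I_m -> {set 'I_n}} => tau @: setT)
  (mem [set P : {set {set 'I_n}} | partition P setT && (#|P| == m)])) /=.
  rewrite mulnC /stirling2 -sum_nat_const; apply: eq_bigr => P.
  rewrite inE => /andP[partP /eqP cardP].
  transitivity (#|[set tau : {ffun 'I_m -> {set 'I_n}}
                    in ffun_on (mem P) | injectiveb tau]|).
    rewrite -sum1_card; apply: eq_bigl => tau; rewrite !inE.
    rewrite -injective_onto_set // -andbA; case: injectiveb => //=.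
    by case: eqP => [->|_]; rewrite ?partP ?andbF.
  by rewrite card_inj_ffuns_on card_ord cardP ffactnn.
move=> tau; rewrite !inE => /andP[/injectiveP tau_inj ->].
by rewrite card_imset // cardsT card_ord eqxx.
Qed.

(** A surjection is determined by its list of fibers, and these lists are exactly the listings
    without repetition of the blocks of a partition. *)
Lemma card_surjections (n m : nat) :
  #|[set sigma : {ffun 'I_n -> 'I_m} | [forall y, y \in codom sigma]]| =
  m`! * stirling2 n m.
Proof.
rewrite -card_ordered_partitions.
pose fibers (sigma : {ffun 'I_n -> 'I_m}) := [ffun y => sigma @^-1: [set y]].
have fibers_inj : injective fibers.
  move=> s1 s2 /ffunP e; apply/ffunP => x.
  have := e (s1 x); rewrite !ffunE => /setP/(_ x).
  by rewrite !inE eqxx => /esym/eqP.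
rewrite -(card_imset _ fibers_inj); apply: eq_card => tau; rewrite !inE.
apply/imsetP/andP => [[sigma]|[/injectiveP tau_inj /and3P[/eqP cov triv tau0]]].
  rewrite inE => /forallP surj ->; split.
    apply/injectiveP => y z; rewrite !ffunE => /setP.
    have /codomP[x ->] := surj y.
    by move=> /(_ x); rewrite !inE eqxx => /esym/eqP.
  apply/and3P; split.
  - apply/eqP/setP => x; rewrite inE; apply/bigcupP.
    exists (fibers sigma (sigma x)); first by rewrite imset_f ?inE.
    by rewrite ffunE !inE.
  - apply/trivIsetP => _ _ /imsetP[y _ ->] /imsetP[z _ ->] yz.
    rewrite !ffunE -setI_eq0; apply/eqP/setP => x; rewrite !inE.
    apply/negP => /andP[/eqP ey /eqP ez]; case/negP: yz.
    by rewrite -ey -ez.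
  - apply/imsetP => -[y _]; have /codomP[x ->] := surj y.
    by rewrite ffunE => /setP/(_ x); rewrite !inE eqxx.
(* Conversely, [s] sends [x] to the index of the block that contains it. *)
have ex x : exists y, x \in tau y.
  have: x \in cover (tau @: setT) by rewrite cov inE.
  by case/bigcupP => _ /imsetP[y _ ->] xy; exists y.
have [s sP] := fin_all_exists ex.
have sE x y : x \in tau y -> s x = y.
  move=> xy; apply: tau_inj; apply/eqP; apply: contraT => neq.
  have /trivIsetP/(_ (tau (s x)) (tau y)) := triv.
  rewrite !imset_f ?inE // => /(_ isT isT neq)/pred0P/(_ x) /=.
  by rewrite xy sP.
have tauE y : tau y = [set x | s x == y].
  apply/setP => x; rewrite inE; apply/idP/eqP => [/sE //|<-]; exact: sP.
exists (finfun s); last first.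
  by apply/ffunP => y; rewrite ffunE tauE; apply/setP => x; rewrite !inE ffunE.
rewrite inE; apply/forallP => y.
have [x xy] : exists x, x \in tau y.
  by apply/set0Pn; apply: contraNneq tau0 => <-; rewrite imset_f ?inE.
by apply/codomP; exists x; rewrite ffunE (sE x y).
Qed.

(** * Ranks *)

Section Rank.

Variables (T : finType) (g : T -> nat) (B : {set T}).

(** Ranks start at 0, hence the [.+1] in later statements, and [v] may be any threshold, not only a
    value of [g]. *)
Definition rank (v : nat) : nat := #|[set z in B | g z < v]|.

Lemma rank_le (v : nat) : rank v <= #|B|.
Proof. by apply/subset_leq_card/subsetP => z; rewrite inE => /andP[]. Qed.

Lemma rank_lt (x : T) (v : nat) : x \in B -> g x < v -> rank (g x) < rank v.
Proof.
move=> xB lt_v; apply/proper_card/properP; split.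
  by apply/subsetP => z; rewrite !inE => /andP[-> /ltn_trans]; apply.
by exists x; rewrite !inE xB ?ltnn.
Qed.

Lemma rank_lt_card (x : T) : x \in B -> rank (g x) < #|B|.
Proof.
by move=> xB; apply: leq_trans (rank_lt xB (ltnSn _)) (rank_le _).
Qed.

Lemma rank_inj : {in B &, injective g} ->
  {in B &, injective (fun x => rank (g x))}.
Proof.
move=> g_inj x y xB yB /= e; apply: g_inj => //.
case: (ltngtP (g x) (g y)) => // [/(rank_lt xB)|/(rank_lt yB)];
  by rewrite e ltnn.
Qed.

Lemma rank_onto (r : nat) : {in B &, injective g} -> r < #|B| ->
  exists2 y, y \in B & rank (g y) = r.
Proof.
move=> g_inj lt_r.
(* Off [B] the rank can be [#|B|], hence the codomain; on [B] the map misses [ord_max], and counting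
   makes it hit everything else. *)
pose h (x : T) : 'I_#|B|.+1 := inord (rank (g x)).
have hE x : h x = rank (g x) :> nat by rewrite inordK // ltnS rank_le.
have h_inj : {in B &, injective h}.
  by move=> x y xB yB /(congr1 val) /=; rewrite !hE; exact: rank_inj.
have sub : h @: B \subset [set~ ord_max].
  apply/subsetP => _ /imsetP[x xB ->]; rewrite !inE -val_eqE /= hE.
  by rewrite neq_ltn rank_lt_card.
have /eqP/setP/(_ (inord r)) : h @: B == [set~ ord_max].
  by rewrite eqEcard sub card_in_imset // cardsC1 card_ord /=.
have lt_r1 := ltn_trans lt_r (ltnSn _).
rewrite !inE -val_eqE /= inordK // neq_ltn lt_r /=.
case/imsetP => y yB /(congr1 val) /=; rewrite hE inordK // => e.
by exists y.
Qed.

End Rank.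

Lemma eq_rank (T : finType) (g h : T -> nat) (B : {set T}) (v w : nat) :
  {in B, forall z, (g z < v) = (h z < w)} -> rank g B v = rank h B w.
Proof.
move=> e; apply: eq_card => z; rewrite !inE.
by case zB: (z \in B) => //=; rewrite e.
Qed.

Lemma superset_of_card (T : finType) (A : {set T}) (m : nat) :
  #|A| <= m <= #|T| -> exists2 D : {set T}, A \subset D & #|D| = m.
Proof.
case/andP; elim: m => [|m IHm] le_m lt_m.
  by exists A => //; apply/eqP; rewrite -leqn0.
case: (leqP #|A| m) => [Am|mA]; last first.
  by exists A => //; apply/eqP; rewrite eqn_leq le_m.
have [D AD cardD] := IHm Am (ltnW lt_m).
have /set0Pn[x] : ~: D != set0.
  by rewrite -card_gt0 -(ltn_add2l #|D|) cardsC addn0 cardD.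
rewrite inE => xD; exists (x |: D); last by rewrite cardsU1 xD cardD.
exact: subset_trans AD (subsetUr _ _).
Qed.

Section MoreRank.

Variables (T : finType) (g : T -> nat) (B : {set T}).

(** An element is not counted below its own value, so the rank of [t j] in [F j] can be computed in
    [F j :\ t j]. *)
Lemma rankD1 (x : T) (v : nat) : v <= g x -> rank g (B :\ x) v = rank g B v.
Proof.
move=> le_v; apply: eq_card => z; rewrite !inE.
by case: (eqVneq z x) => //= ->; rewrite ltnNge le_v andbF.
Qed.

Lemma rank_all (v : nat) : {in B, forall z, g z < v} -> rank g B v = #|B|.
Proof.
move=> lt_v; apply: eq_card => z; rewrite inE.
by case zB: (z \in B) => //=; rewrite lt_v.
Qed.

(** Unlike in [rank_onto], [r] can be [#|B|]: a threshold above all values serves to insert a new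
    largest element. *)
Lemma rank_gap (r : nat) : {in B &, injective g} -> r <= #|B| ->
  exists v, rank g B v = r.
Proof.
move=> g_inj; rewrite leq_eqVlt => /predU1P[->|/(rank_onto g_inj)[y _ <-]].
  exists (\max_(y in B) g y).+1; apply: rank_all => z zB.
  by rewrite ltnS leq_bigmax_cond.
by exists (g y).
Qed.

End MoreRank.

(** * Every configuration is realized *)

Section Realization.

Variables (n : nat) (F : 'I_n -> {set 'I_n}) (t : 'I_n -> 'I_n).
Variable f : 'I_n -> nat.

Lemma card_ord_lt (k : nat) : k <= n -> #|[set i : 'I_n | i < k]| = k.
Proof.
move=> le_k; rewrite -sum1_card (eq_bigl (fun i : 'I_n => i < k)).
  by rewrite -(big_ord_widen _ (fun=> 1)) // sum1_card card_ord.
by move=> i; rewrite inE.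
Qed.

(** The first [k] members have [k] distinct transversal elements in their union, which has only [k]
    elements. *)
Lemma shelling_transversal (s : {perm 'I_n}) (k : nat) :
  family_transversal F t ->
  (forall k : nat, 1 <= k <= n -> #|\bigcup_(i : 'I_n | i < k) F (s i)| = k) ->
  k <= n ->
  [set t (s i) | i in [set i : 'I_n | i < k]] =
    \bigcup_(i : 'I_n | i < k) F (s i).
Proof.
move=> [t_inj tF] shell le_k; apply/eqP; rewrite eqEcard; apply/andP; split.
  apply/subsetP => _ /imsetP[i + ->]; rewrite inE => lt_i.
  by apply/bigcupP; exists i.
rewrite card_imset; last by apply: inj_comp => //; apply: perm_inj.
rewrite card_ord_lt //; case: k le_k => [|k] le_k; last by rewrite shell.
by rewrite big_pred0_eq cards0.
Qed.

(* Insert the elements t (s 0), t (s 1), ... one at a time: doubling the old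
   values leaves the even numbers free for the new one. *)
Lemma injective_realization :
  shellable F -> family_transversal F t -> configuration F t f ->
  exists2 g : 'I_n -> nat, injective g &
    forall j, (rank g (F j) (g (t j))).+1 = f (t j).
Proof.
move=> [s shell] tr /andP[/forallP f_gt0 /forallP f_le].
have [t_inj tF] := tr.
pose b i := t (s i).
have b_inj : injective b by apply: inj_comp => //; apply: perm_inj.
pose E k := [set b i | i in [set i : 'I_n | i < k]].
have memE i k : (b i \in E k) = (i < k) by rewrite mem_imset // inE.
have EP y k : y \in E k -> exists2 i, y = b i & i < k.
  by case/imsetP => i; rewrite inE; exists i.
have subE (i : 'I_n) k : i < k -> k <= n -> F (s i) \subset E k.
  by move=> lt_i le_k; rewrite /E shelling_transversal // (bigcup_max i).
suff main k : k <= n -> exists2 g : 'I_n -> nat, {in E k &, injective g} &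
    forall i : 'I_n, i < k -> (rank g (F (s i)) (g (b i))).+1 = f (b i).
  have [g g_inj gf] := main n (leqnn n).
  have [b' bK b'K] := injF_bij b_inj.
  have inE_n x : x \in E n by rewrite -[x]b'K memE.
  exists g => [x y|j]; first exact: g_inj.
  by have := gf (s^-1%g j) (ltn_ord _); rewrite /b permKV.
elim: k => [_|k IHk lt_k].
  by exists (fun=> 0) => // x y /EP[].
have [g g_inj gf] := IHk (ltnW lt_k).
pose i0 := Ordinal lt_k; pose x := b i0.
have xE : x \notin E k by rewrite memE ltnn.
have ES y : y \in E k.+1 -> y != x -> y \in E k.
  case/EP => i ->; rewrite ltnS leq_eqVlt memE => /predU1P[ik|-> //].
  by rewrite (_ : i = i0) ?eqxx //; apply: val_inj.
have subB : F (s i0) :\ x \subset E k.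
  apply/subsetP => y; rewrite !inE => /andP[yx yF].
  by apply: ES => //; apply: subsetP yF; apply: subE.
have [v vE] : exists v, rank g (F (s i0) :\ x) v = (f x).-1.
  apply: rank_gap.
    by move=> y z yB zB; apply: g_inj; apply: (subsetP subB).
  rewrite -ltnS (ltn_predK (f_gt0 _)) (leq_trans (f_le _)) //.
  by rewrite (cardsD1 x (F _)) tF.
pose g' y := if y == x then v.*2 else (g y).*2.+1.
have g'x : g' x = v.*2 by rewrite /g' eqxx.
have g'E y : y != x -> g' y = (g y).*2.+1 by rewrite /g' => /negPf ->.
exists g' => [y z yE zE|i].
  rewrite /g'; case: eqP => [->|/eqP yx]; case: eqP => [->|/eqP zx] //.
  - by move/(congr1 odd); rewrite /= !odd_double.
  - by move/(congr1 odd); rewrite /= !odd_double.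
  - by case=> /double_inj; apply: g_inj; apply: ES.
rewrite ltnS leq_eqVlt => /predU1P[ik|lt_i].
  have -> : i = i0 by apply: val_inj.
  rewrite -/x -(rankD1 _ (leqnn _)) g'x -(ltn_predK (f_gt0 x)) -vE; congr _.+1.
  apply: eq_rank => z; rewrite !inE => /andP[zx _].
  by rewrite g'E // ltn_Sdouble.
(* Earlier members lie in [E k], so they do not contain the new [x], and doubling plus one keeps the
   order of their values. *)
have Fx : {in F (s i), forall z, z != x}.
  move=> z zF; apply: contraNneq xE => <-.
  by apply: subsetP zF; apply: subE => //; apply: ltnW.
rewrite -gf //; congr _.+1; apply: eq_rank => z zF.
by rewrite !g'E ?Fx ?tF // ltnS ltn_double.
Qed.

(* Moving an element u of S to the top when some element of S has to be the
   largest one of its set, the other elements x of S can be glued onto D: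
   either to the element of rank f x in the rest of their set, or to u. *)
Lemma glued_realization (m : nat) (g : 'I_n -> nat) :
  family_transversal F t -> configuration F t f ->
  n - #|in_exactly_one F| + 1 <= m <= n ->
  injective g -> (forall j, (rank g (F j) (g (t j))).+1 = f (t j)) ->
  exists (h : 'I_n -> nat) (D : {set 'I_n}),
    [/\ #|D| = m, {in D &, injective h},
        forall x, exists2 y, y \in D & h y = h x,
        forall j, {in F j :\ t j &, injective h} &
        forall j, (rank h (F j) (h (t j))).+1 = f (t j)].
Proof.
move=> [t_inj tF] /andP[/forallP f_gt0 /forallP f_le] m_bounds g_inj gf.
pose S := in_exactly_one F.
have [t' t'K tK] := injF_bij t_inj.
have uniqS i j : t i \in S -> t i \in F j -> j = i.
  rewrite inE => /cards1P[j0 e] iF.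
  have /set1P -> : j \in [set j0] by rewrite -e inE.
  have /set1P -> // : i \in [set j0] by rewrite -e inE.
(* Only [t j] can belong to [S] within [F j], so moving elements of [S] affects the condition at [j]
   only through [t j]. *)
have restS j : {in F j :\ t j, forall z, z \notin S}.
  move=> z; rewrite -[z]tK in_setD1 => /andP[neq zF]; apply: contraNN neq => zS.
  by rewrite (uniqS (t' z) j).
have cardF j : #|F j| = #|F j :\ t j|.+1 by rewrite (cardsD1 (t j)) tF.
pose top j := f (t j) == #|F j|.
(* The index of the common top element: [top ju] holds as soon as [top] holds for some member with
   transversal element in [S]. *)
have [ju juS ju_top] : exists2 ju, t ju \in S &
    forall j, t j \in S -> top j -> top ju.
  have [/existsP[j /andP[jS j_top]]|no_top] :=
    boolP [exists j, (t j \in S) && top j]; first by exists j.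
  (* For empty [S] the bounds would read [n + 1 <= m <= n]. *)
  have /set0Pn[x xS] : S != set0.
    rewrite -cards_eq0; apply: contraTneq m_bounds => S0.
    rewrite -/S S0 subn0 addn1; apply/andP => -[/leq_trans h /h].
    by rewrite ltnn.
  exists (t' x) => [|j jS j_top]; first by rewrite tK.
  by case/existsP: no_top; exists j; rewrite jS.
pose u := t ju; pose M := (\max_y g y).+1.
have gM y : g y < M by rewrite ltnS leq_bigmax.
(* Raising [u] keeps all ranks: [u] lies in [F ju] only and, when [top ju] holds, is already the
   largest there. *)
pose g1 x := if (x == u) && top ju then M else g x.
have g1E x : x != u -> g1 x = g x by rewrite /g1 => /negPf ->.
have g1_inj : injective g1.
  move=> x y; rewrite /g1; case: (eqVneq x u) => [->|xu];
    case: (eqVneq y u) => [->|yu] //=; case: (top ju) => //;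
    try by move/g_inj.
    by move=> e; have := gM y; rewrite -e ltnn.
  by move=> e; have := gM x; rewrite e ltnn.
have notS_neq_u z : z \notin S -> z != u by apply: contraNneq => ->.
have g1f j : (rank g1 (F j) (g1 (t j))).+1 = f (t j).
  have [ju_isT|ju_notT] := boolP (top ju); last first.
    rewrite -gf; congr _.+1; apply: eq_rank => z _.
    by rewrite /g1 (negPf ju_notT) !andbF.
  have [->|neq] := eqVneq j ju.
    rewrite -(rankD1 _ (leqnn _)) (eqP ju_isT) cardF; congr _.+1.
    apply: rank_all => z /restS/notS_neq_u zu.
    by rewrite (g1E z) // /g1 eqxx ju_isT.
  have ne z : z \in F j -> z != u.
    by move=> zF; apply: contraNneq neq => zu; rewrite (uniqS ju j) // -/u -zu.
  by rewrite -gf; congr _.+1; apply: eq_rank => z zF; rewrite !g1E // ne.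
(* [u |: ~: S] has [n - #|S| + 1] elements, the lower bound on [m]. *)
have [D subD cardD] : exists2 D : {set 'I_n}, u |: ~: S \subset D & #|D| = m.
  apply: superset_of_card; rewrite cardsU1 inE negbK juS cardsCs setCK.
  by rewrite card_ord addnC.
have notS_D z : z \notin S -> z \in D.
  by move=> zS; apply: (subsetP subD); rewrite in_setU in_setC zS orbT.
have uD : u \in D by apply: (subsetP subD); rewrite !inE eqxx.
(* One existential covers both cases, so that [fin_all_exists] yields a single [h]: unchanged on
   [D], glued to a value on [D] elsewhere. *)
have glue x : exists v, if x \in D then v = g1 x else
    (exists2 y, y \in D & g1 y = v) /\
    forall j, t j = x -> rank g1 (F j :\ x) v = (f x).-1.
  have [xD|xD] := boolP (x \in D); first by exists (g1 x).
  have xS : x \in S by apply: contraNT xD => /notS_D.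
  have [j xj] : exists j, t j = x by exists (t' x).
  move: xD xS; rewrite -{x}xj => xD xS.
  suff [y yD yr] : exists2 y, y \in D &
      rank g1 (F j :\ t j) (g1 y) = (f (t j)).-1.
    by exists (g1 y); split=> [|i /t_inj ->]; first by exists y.
  have [is_top|not_top] := boolP (top j).
    exists u => //; rewrite (eqP is_top) cardF /=.
    apply: rank_all => z /restS/notS_neq_u zu.
    by rewrite (g1E z) // /g1 eqxx (ju_top _ xS is_top).
  have [|//|y yB yr] := @rank_onto _ g1 (F j :\ t j) (f (t j)).-1.
  - by move=> y z _ _; apply: g1_inj.
  - by rewrite -ltnS -cardF (ltn_predK (f_gt0 _)) ltn_neqAle f_le andbT.
  by exists y => //; apply/notS_D/restS/yB.
have [h hP] := fin_all_exists glue.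
have hD x : x \in D -> h x = g1 x by move=> xD; have := hP x; rewrite xD.
exists h, D; split=> //.
- by move=> x y xD yD; rewrite !hD //; apply: g1_inj.
- move=> x; have := hP x; case: ifPn => [xD _|_ [[y yD yx] _]].
    by exists x.
  by exists y => //; rewrite hD.
- move=> j x y /restS/notS_D xD /restS/notS_D yD.
  by rewrite !hD //; apply: g1_inj.
move=> j; rewrite -(rankD1 _ (leqnn _)).
rewrite (@eq_rank _ _ g1 _ _ (h (t j))); last first.
  by move=> z /restS/notS_D zD; rewrite hD.
have := hP (t j); case: ifPn => [xD ->|_ [_ /(_ j erefl) ->]].
  by rewrite rankD1.
exact: ltn_predK (f_gt0 _).
Qed.

(* The hypothesis on F j makes the rank in F j, which counts elements, agree
   with kth_smallest, which counts values. *)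
Lemma surjective_realization (m : nat) (h : 'I_n -> nat) (D : {set 'I_n}) :
  #|D| = m -> {in D &, injective h} ->
  (forall x, exists2 y, y \in D & h y = h x) ->
  (forall j, {in F j :\ t j &, injective h}) ->
  (forall j, t j \in F j) ->
  (forall j, (rank h (F j) (h (t j))).+1 = f (t j)) ->
  0 < num_satisfying F m t f.
Proof.
move=> cardD hD_inj hD hF_inj tF hf.
have lt_m x : rank h D (h x) < m.
  by have [y yD <-] := hD x; rewrite -cardD rank_lt_card.
(* All values of [h] occur on [D]; numbering them in increasing order from 0 gives a map onto
   ['I_m]. *)
pose sigma : {ffun 'I_n -> 'I_m} := [ffun x => Ordinal (lt_m x)].
have sigmaE x : sigma x = rank h D (h x) :> nat by rewrite ffunE.
have sigma_homo x y : h x < h y -> sigma x < sigma y.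
  by rewrite !sigmaE; have [z zD <-] := hD x => /rank_lt; apply.
have sigma_lt x y : (sigma x < sigma y) = (h x < h y).
  case: (ltngtP (h x) (h y)) => [/sigma_homo // | /sigma_homo/ltnW | e].
    by rewrite leqNgt => /negPf.
  by rewrite !sigmaE e ltnn.
have sigma_inj x y : sigma x = sigma y -> h x = h y.
  move=> e; case: (ltngtP (h x) (h y)) => // /sigma_homo;
  by rewrite e ltnn.
apply/card_gt0P; exists sigma; rewrite inE; apply/andP; split.
  apply/forallP => y; have lt_y : y < #|D| by rewrite cardD.
  have [x xD xy] := rank_onto hD_inj lt_y.
  by apply/codomP; exists x; apply: val_inj; rewrite /= sigmaE.
apply/forallP => j; rewrite /kth_smallest imset_f //= -hf eqSS; apply/eqP.
have -> : [set y in sigma @: F j | y < sigma (t j)] =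
    sigma @: [set z in F j | h z < h (t j)].
  apply/setP => y; rewrite inE; apply/andP/imsetP => [[/imsetP[z zF ->]]|[z]].
    by rewrite sigma_lt => lt_z; exists z; rewrite // inE zF.
  by rewrite inE => /andP[zF lt_z] ->; rewrite sigma_lt imset_f.
rewrite card_in_imset // => x y; rewrite !inE.
move=> /andP[xF lt_x] /andP[yF lt_y] /sigma_inj.
(* Elements below [t j] differ from [t j], so injectivity on [F j :\ t j] gives as many values as
   elements. *)
have neq_t z : h z < h (t j) -> z != t j.
  by apply: contraTneq => ->; rewrite ltnn.
by apply: (hF_inj j); rewrite in_setD1 neq_t.
Qed.

Lemma realized (m : nat) :
  shellable F -> family_transversal F t ->
  n - #|in_exactly_one F| + 1 <= m <= n ->
  configuration F t f -> 0 < num_satisfying F m t f.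
Proof.
move=> shell tr m_bounds conf.
have [g g_inj gf] := injective_realization shell tr conf.
have [h [D [? ? ? ? ?]]] := glued_realization tr conf m_bounds g_inj gf.
by apply: (@surjective_realization m h D) => //; case: tr.
Qed.

End Realization.

(** * Counting *)

Section Counting.

Variables (n : nat) (F : 'I_n -> {set 'I_n}) (t : 'I_n -> 'I_n) (m : nat).

(** [phi sigma] reads off the ranks of [sigma] and is the only configuration that [sigma] satisfies,
    so the sets counted partition the surjections. *)
Lemma sum_num_satisfying : family_transversal F t ->
  \sum_(f in realized_configurations F m t) num_satisfying F m t (fun x => f x)
    = m`! * stirling2 n m.
Proof.
move=> [t_inj tF]; have [t' t'K tK] := injF_bij t_inj.
pose r (sigma : {ffun 'I_n -> 'I_m}) j :=
  #|[set y in sigma @: F j | y < sigma (t j)]|.+1.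
have r_le sigma j : r sigma j <= #|F j|.
  apply: leq_trans (leq_imset_card sigma _); apply/proper_card/properP; split.
    by apply/subsetP => y; rewrite inE => /andP[].
  by exists (sigma (t j)); rewrite ?imset_f // inE ltnn andbF.
(* [inord] loses nothing, as [r sigma j <= #|F j| <= n]. *)
pose phi sigma : {ffun 'I_n -> 'I_n.+1} := [ffun x => inord (r sigma (t' x))].
have phiE sigma j : phi sigma (t j) = r sigma j :> nat.
  rewrite ffunE t'K inordK // ltnS (leq_trans (r_le _ _)) //.
  by rewrite (leq_trans (max_card _)) ?card_ord.
have satE (sigma : {ffun 'I_n -> 'I_m}) (f : {ffun 'I_n -> 'I_n.+1}) :
    satisfies F t (fun x => f x) sigma = (phi sigma == f).
  apply/forallP/eqP => [sat|<- j].
    apply/ffunP => x; apply: val_inj; rewrite -[x]tK /= phiE.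
    by have /andP[_ /eqP] := sat (t' x).
  by rewrite /kth_smallest imset_f //= phiE.
rewrite -card_surjections -[in RHS]sum1_card.
rewrite (partition_big phi (mem (realized_configurations F m t))) /=.
  apply: eq_bigr => f _; rewrite sum1dep_card; apply: eq_card => sigma.
  by rewrite !inE satE.
move=> sigma; rewrite inE => surj; rewrite inE; apply/andP; split.
  apply/andP; split; apply/forallP => j; last by rewrite phiE.
  by rewrite -[j]tK phiE.
by apply/card_gt0P; exists sigma; rewrite inE surj satE eqxx.
Qed.

(** Since [t] is a bijection, a configuration is a free choice of a value from 1 to [#|F j|] at each
    [t j]. *)
Lemma card_configurations : family_transversal F t ->
  #|[set f : {ffun 'I_n -> 'I_n.+1} | configuration F t (fun x => f x)]| =
  \prod_(j < n) #|F j|.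
Proof.
move=> [t_inj tF]; have [t' t'K tK] := injF_bij t_inj.
transitivity #|family (fun x => [pred k : 'I_n.+1 | 0 < k <= #|F (t' x)|])|.
  apply: eq_card => f; rewrite inE; apply/andP/familyP.
    move=> [/forallP f_gt0 /forallP f_le] x; rewrite inE f_gt0 /=.
    by rewrite -{1}[x]tK f_le.
  move=> f_in; split; apply/forallP => j.
    by have := f_in j; rewrite inE => /andP[].
  by have := f_in (t j); rewrite inE t'K => /andP[].
rewrite card_family foldrE big_map big_enum /= (reindex t) /=; last first.
  by exists t' => x _.
apply: eq_bigr => j _; rewrite t'K.
have le_n : #|F j| <= n by rewrite (leq_trans (max_card _)) ?card_ord.
have lift_inj : injective (fun k : 'I_#|F j| => inord k.+1 : 'I_n.+1).
  move=> k l /(congr1 val) /=; rewrite !inordK ?ltnS ?(leq_trans _ le_n) //.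
  by move=> [] /val_inj.
rewrite -[RHS]card_ord -(card_imset _ lift_inj); apply: eq_card => k.
rewrite [LHS]inE; apply/andP/imsetP => [[k_gt0 k_le]|[l _ ->]].
  have lt_k : k.-1 < #|F j| by rewrite (ltn_predK k_gt0).
  by exists (Ordinal lt_k); rewrite ?inE //= (ltn_predK k_gt0) inord_val.
by rewrite inordK // ltnS (leq_trans _ le_n).
Qed.

End Counting.

Theorem theorem3p27 (n : nat) (F : 'I_n -> {set 'I_n}) (t : 'I_n -> 'I_n)
    (m : nat) :
  0 < n ->
  shellable F ->
  family_transversal F t ->
  n - #|in_exactly_one F| + 1 <= m <= n ->
  average_num_satisfying F m t =
    ((m`! * stirling2 n m)%:R / (\prod_(j < n) #|F j|)%:R)%R.
Proof.
move=> _ shell tr m_bounds.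
have cardX : #|realized_configurations F m t| = \prod_(j < n) #|F j|.
  rewrite -(card_configurations tr); apply: eq_card => f; rewrite !inE.
  by apply/andb_idr/realized.
rewrite /average_num_satisfying -GRing.natr_sum sum_num_satisfying // cardX.
(* Each [F j] contains [t j], so the product is positive and the average is the quotient, not the
   default 0. *)
rewrite prodn_cond_gt0 // => j _.
by apply/card_gt0P; exists (t j); case: tr => _ ->.
Qed.
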